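(* Let $n\ge2$ and let $\mathcal D$ be an ordered, oriented Descartes configuration in $\mathbb R^n$. Consider the orbit of $\mathcal D$ under the dual Apollonian group $\mathcal A_n^\perp$, i.e. the set of ordered, oriented Descartes configurations $\mathcal D'$ with $\mathbf W_{\mathcal D'}=\mathbf U\mathbf W_{\mathcal D}$ for some $\mathbf U\in\mathcal A_n^\perp$. Then no two spheres belonging to distinct Descartes configurations of the orbit cross each other: any two such spheres either coincide, or are disjoint, or are tangent.
   Context: ''Sphere'' means an $(n-1)$-sphere in $\mathbb R^n$, hyperplanes being allowed as degenerate spheres (passing through $\infty$); ''coincide'' refers to the underlying unoriented spheres. An oriented sphere is a sphere with a chosen direction of unit normal; its signed curvature is $b=1/r$ for the inward normal and $b=-1/r$ for the outward normal ($r$ the radius), and its interior is the usual interior for the inward normal and the exterior for the outward normal. An oriented hyperplane has signed curvature $0$ and its interior is the open half-space into which its chosen unit normal points. A Descartes configuration in $\mathbb R^n$ consists of $n+2$ pairwise tangent spheres with all points of tangency distinct (parallel hyperplanes are tangent at $\infty$). It is oriented if its spheres are oriented so that either the interiors of all $n+2$ oriented spheres are pairwise disjoint, or they are pairwise disjoint after reversing all orientations. The augmented curvature-center coordinates of an oriented sphere $S$ with signed curvature $b\neq0$ and center $(x_1,\dots,x_n)$ are the row vector $\mathbf w(S)=(\bar b,b,bx_1,\dots,bx_n)$, where $\bar b=b|\mathbf x|^2-1/b$. For an oriented hyperplane $\{\mathbf y:\mathbf y\cdot\mathbf h=m\}$ with unit normal $\mathbf h$, $\mathbf w=(2m,0,h_1,\dots,h_n)$.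 For an ordered, oriented Descartes configuration $\mathcal D=(S_1,\dots,S_{n+2})$, $\mathbf W_{\mathcal D}$ is the $(n+2)\times(n+2)$ matrix with $j$-th row $\mathbf w(S_j)$. Known fact: $\mathcal D\mapsto\mathbf W_{\mathcal D}$ is a bijection from ordered, oriented Descartes configurations onto the real matrices $\mathbf W$ with $\mathbf W^T\mathbf Q_{D,n}\mathbf W=\mathbf Q_{W,n}$, where $\mathbf{Q}_{D,n}=\mathbf{I}_{n+2}-\frac1n\mathbf{1}\mathbf{1}^T$ and $\mathbf{Q}_{W,n}=\begin{pmatrix}0&-4&0\\-4&0&0\\0&0&2\mathbf{I}_n\end{pmatrix}$. Hence any $\mathbf U$ with $\mathbf U^T\mathbf Q_{D,n}\mathbf U=\mathbf Q_{D,n}$ acts on such configurations by $\mathbf W_{\mathcal D}\mapsto\mathbf U\mathbf W_{\mathcal D}$. The dual Apollonian group $\mathcal A_n^\perp$ is the group generated by the matrices $\mathbf S_j^\perp=\mathbf I_{n+2}+2\,\mathbf 1\mathbf e_j^T-4\,\mathbf e_j\mathbf e_j^T$, $1\le j\le n+2$ (where $\mathbf e_j$ is the $j$-th standard column vector and $\mathbf 1=(1,\dots,1)^T$), all of which preserve $\mathbf Q_{D,n}$ in this sense. *)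

(* Defs.v *)
From HB Require Import structures.
From mathcomp Require Import all_boot all_order all_algebra.
From mathcomp Require Import classical_sets reals.

Set Implicit Arguments.
Unset Strict Implicit.
Unset Printing Implicit Defensive.

Import Order.TTheory GRing.Theory Num.Theory.
Local Open Scope classical_set_scope.
Local Open Scope ring_scope.

Section Spheres.
Context {R : realType} {n : nat}.
Implicit Types (x y h : 'rV[R]_n) (r m : R).

Definition dot x y : R := \sum_i x 0 i * y 0 i.
(* The canonical norm on ['rV[R]_n] is the sup norm; spheres need this one. *)
Definition enorm x : R := Num.sqrt (dot x x).

(* [Sphere x r inward] has center [x], radius [r] and inward unit normal iff
   [inward = true]; [Hyperplane h m] is {y | y.h = m} with unit normal [h]. *)
Inductive osphere : Type :=
| Sphere x r (inward : bool) of 0 < r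
| Hyperplane h m of enorm h == 1.

Lemma enorm_opp_eq1 h : enorm h == 1 -> enorm (- h) == 1.
Proof.
rewrite /enorm /dot => /eqP <-; apply/eqP; congr Num.sqrt.
by apply: eq_bigr => i _; rewrite !mxE mulrNN.
Qed.

Definition reverse (S : osphere) : osphere :=
  match S with
  | Sphere x r inward hr => Sphere x (~~ inward) hr
  | Hyperplane h m hh => Hyperplane (- m) (enorm_opp_eq1 hh)
  end.

(* The underlying unoriented sphere, as a subset of R^n with the point [None]
   at infinity added. *)
Definition carrier (S : osphere) : set (option 'rV[R]_n) :=
  [set p | match S, p with
           | Sphere x r _ _, Some y => enorm (y - x) = r
           | Sphere _ _ _ _, None => False
           | Hyperplane h m _, Some y => dot y h = m
           | Hyperplane _ _ _, None => True
           end].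

Definition sphere_interior (S : osphere) : set 'rV[R]_n :=
  [set y | match S with
           | Sphere x r true _ => enorm (y - x) < r
           | Sphere x r false _ => r < enorm (y - x)
           | Hyperplane h m _ => m < dot y h
           end].

Definition coincide (S T : osphere) : Prop := carrier S = carrier T.

Definition disjoint_spheres (S T : osphere) : Prop :=
  carrier S `&` carrier T = set0.

(* Meaningful for [2 <= n] only: 0-spheres can share one of their two points.
   Distinct parallel hyperplanes are tangent at [None], while intersecting ones
   share [None] and at least one finite point, hence are not tangent. *)
Definition tangent_at (S T : osphere) (p : option 'rV[R]_n) : Prop :=
  carrier S `&` carrier T = [set p].

Definition tangent (S T : osphere) : Prop := exists p, tangent_at S T p.

Definition signed_curvature (S : osphere) : R :=
  match S with
  | Sphere _ r inward _ => if inward then r^-1 else - r^-1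
  | Hyperplane _ _ _ => 0
  end.

Definition acc_coords (S : osphere) : 'rV[R]_(1 + (1 + n)) :=
  let b := signed_curvature S in
  match S with
  | Sphere x r _ _ =>
      row_mx (b * enorm x ^+ 2 - b^-1)%:M (row_mx b%:M (b *: x))
  | Hyperplane h m _ => row_mx (2 * m)%:M (row_mx b%:M h)
  end.

Definition ordered_spheres : Type := 'I_n.+2 -> osphere.

Definition descartes (D : ordered_spheres) : Prop :=
  (forall i j, i != j -> tangent (D i) (D j)) /\
  (forall (i j k l : 'I_n.+2) p, (i < j)%N -> (k < l)%N ->
     tangent_at (D i) (D j) p -> tangent_at (D k) (D l) p ->
     i = k /\ j = l).

Definition disjoint_interiors (D : ordered_spheres) : Prop :=
  forall i j, i != j ->
    sphere_interior (D i) `&` sphere_interior (D j) = set0.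

Definition oriented_descartes (D : ordered_spheres) : Prop :=
  descartes D /\
  (disjoint_interiors D \/ disjoint_interiors (fun i => reverse (D i))).

Definition acc_matrix (D : ordered_spheres) : 'M[R]_n.+2 :=
  \matrix_(i, j) acc_coords (D i) 0 j.

End Spheres.

Arguments osphere : clear implicits.
Arguments ordered_spheres : clear implicits.

Section DualApollonianGroup.
Context {R : realType} {n : nat}.

Definition dual_gen (j : 'I_n.+2) : 'M[R]_n.+2 :=
  1%:M + 2 *: ((const_mx 1 : 'cV_n.+2) *m delta_mx 0 j) - 4 *: delta_mx j j.

Inductive dual_apollonian : 'M[R]_n.+2 -> Prop :=
| dual_apollonian_gen j : dual_apollonian (dual_gen j)
| dual_apollonian1 : dual_apollonian 1%:M
| dual_apollonianM U V :
    dual_apollonian U -> dual_apollonian V -> dual_apollonian (U *m V)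
| dual_apollonianV U : dual_apollonian U -> dual_apollonian (invmx U).

Definition dual_orbit (D : ordered_spheres R n) : set (ordered_spheres R n) :=
  [set D' | oriented_descartes D' /\
     exists2 U, dual_apollonian U & acc_matrix D' = U *m acc_matrix D].

End DualApollonianGroup.

(* Main.v *)
(** Writing $\mathbf w(S)=(a,b,c)$, the pairing
    $c\cdot c'-(ab'+a'b)/2 = 2\,\mathbf w\,\mathbf Q_{W,n}^{-1}\mathbf w'^T$ of
    two oriented spheres is the inner product of their unit normals at any
    common point.  Hence spheres whose pairing has absolute value at least 1 do
    not cross, and the spheres of an oriented Descartes configuration have Gram
    matrix $2\mathbf I-\mathbf 1\mathbf 1^T$.  Every element of the dual
    Apollonian group is an integer matrix congruent to the identity modulo 2, so
    the pairing of any two spheres of the orbit is an odd integer, and its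
    absolute value is at least 1. *)
Require Import Defs.
From mathcomp Require Import all_boot all_order all_algebra.
From mathcomp Require Import classical_sets reals.
From mathcomp Require Import boolp ring lra zify.

Import Order.TTheory GRing.Theory Num.Theory.

Local Open Scope classical_set_scope.
Local Open Scope ring_scope.

(** * The Euclidean inner product on row vectors *)

Section Dot.
Context {R : realType} {n : nat}.
Implicit Types (x y z : 'rV[R]_n) (k : R).

Lemma dotC x y : dot x y = dot y x.
Proof. by apply: eq_bigr => i _; rewrite mulrC. Qed.

Lemma dotDl x y z : dot (x + y) z = dot x z + dot y z.
Proof.
by rewrite /dot -big_split /=; apply: eq_bigr => i _; rewrite mxE mulrDl.
Qed.

Lemma dotZl k x z : dot (k *: x) z = k * dot x z.
Proof.
by rewrite /dot mulr_sumr; apply: eq_bigr => i _; rewrite mxE mulrA.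
Qed.

Lemma dotNl x z : dot (- x) z = - dot x z.
Proof. by rewrite -scaleN1r dotZl mulN1r. Qed.

Lemma dotDr x y z : dot z (x + y) = dot z x + dot z y.
Proof. by rewrite dotC dotDl !(dotC z). Qed.

Lemma dotZr k x z : dot z (k *: x) = k * dot z x.
Proof. by rewrite dotC dotZl (dotC z). Qed.

Lemma dotNr x z : dot z (- x) = - dot z x.
Proof. by rewrite dotC dotNl (dotC z). Qed.

Definition dotE := (dotDl, dotDr, dotNl, dotNr, dotZl, dotZr).

Lemma dot_ge0 x : 0 <= dot x x.
Proof. by apply: sumr_ge0 => i _; rewrite -expr2 sqr_ge0. Qed.

Lemma dot_eq0 x : dot x x = 0 -> x = 0.
Proof.
move=> /eqP; rewrite psumr_eq0 => [/allP x0|i _]; last by rewrite -expr2 sqr_ge0.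
apply/rowP => i; rewrite mxE; apply/eqP.
by move: (x0 i); rewrite mem_index_enum mulf_eq0 orbb => /(_ isT).
Qed.

Lemma enorm_sqr x : enorm x ^+ 2 = dot x x.
Proof. by rewrite sqr_sqrtr ?dot_ge0. Qed.

Lemma enorm_ge0 x : 0 <= enorm x.
Proof. exact: sqrtr_ge0. Qed.

Lemma dot_unit_le1 x y : dot x x = 1 -> dot y y = 1 -> `|dot x y| <= 1.
Proof.
move=> x1 y1; have := dot_ge0 (x - y); have := dot_ge0 (x + y).
rewrite !dotE x1 y1 (dotC y x) ler_norml => ? ?; apply/andP; split; lra.
Qed.

Lemma dot_unit_eq x y : dot x x = 1 -> dot y y = 1 -> dot x y = 1 -> x = y.
Proof.
move=> x1 y1 xy1; apply/eqP; rewrite -subr_eq0; apply/eqP/dot_eq0.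
by rewrite !dotE x1 y1 (dotC y x) xy1; ring.
Qed.

(** The Gram determinant $1-q^2$ of [x] and [y] is nonzero, so Cramer's rule gives a solution in
    their span. *)
Lemma dot_unit_solve x y (s t : R) :
  dot x x = 1 -> dot y y = 1 -> `|dot x y| < 1 ->
  exists z, dot x z = s /\ dot y z = t.
Proof.
move=> x1 y1; rewrite ltr_norml => /andP[q_gt q_lt]; set q := dot x y in q_gt q_lt.
have q0 : 1 - q ^+ 2 != 0 by apply: lt0r_neq0; nra.
exists (((s - q * t) / (1 - q ^+ 2)) *: x + ((t - q * s) / (1 - q ^+ 2)) *: y).
by rewrite !dotE x1 y1 (dotC y x) -/q; split; field.
Qed.

End Dot.

(** * Coordinates of oriented spheres and the equations they define *)

Section Coordinates.
Context {R : realType} {n : nat}.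
Implicit Types (S T : osphere R n) (y z : 'rV[R]_n) (p : option 'rV[R]_n).

(** The coordinate $\bar b$, which is the signed curvature of the image under inversion in the unit
    sphere. *)
Definition cocurvature S : R :=
  match S with
  | Sphere x _ _ _ => signed_curvature S * enorm x ^+ 2 - (signed_curvature S)^-1
  | Hyperplane _ m _ => 2 * m
  end.

Definition scaled_center S : 'rV[R]_n :=
  match S with
  | Sphere x _ _ _ => signed_curvature S *: x
  | Hyperplane h _ _ => h
  end.

Local Notation a := cocurvature.
Local Notation b := signed_curvature.
Local Notation c := scaled_center.

Lemma acc_coordsE S :
  acc_coords S = row_mx (a S)%:M (row_mx (b S)%:M (c S)).
Proof. by case: S. Qed.

Lemma cocurvature_reverse S : a (reverse S) = - a S.
Proof. by case: S => [x r [] r0|h m h1] /=; rewrite ?invrN; ring. Qed.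

Lemma signed_curvature_reverse S : b (reverse S) = - b S.
Proof. by case: S => [x r [] r0|h m h1] /=; rewrite ?opprK ?oppr0. Qed.

Lemma scaled_center_reverse S : c (reverse S) = - c S.
Proof. by case: S => [x r [] r0|h m h1] //=; rewrite scaleNr ?opprK. Qed.

Lemma carrier_reverse S : carrier (reverse S) = carrier S.
Proof.
case: S => [x r e r0|h m h1]; apply/seteqP; split => -[y|] //=.
- by rewrite dotNr => /oppr_inj.
- by rewrite dotNr => ->.
Qed.

(** One polynomial serves spheres and hyperplanes: it vanishes on the carrier and is negative
    exactly on the interior, the signs of the coordinates recording the orientation. *)
Definition sphere_eqn S y : R := a S + b S * dot y y - 2 * dot (c S) y.

Definition carrier_eqn S p : Prop :=
  if p is Some y then sphere_eqn S y = 0 else b S = 0.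

Lemma sphere_eqn_center x r e (r0 : 0 < r) y :
  let S := Sphere x e r0 in
  sphere_eqn S y = b S * (enorm (y - x) ^+ 2 - r ^+ 2).
Proof.
rewrite /sphere_eqn /= !enorm_sqr !dotE (dotC y x).
by case: e; rewrite ?invrN invrK; field; rewrite gt_eqF.
Qed.

Lemma carrierP S p : carrier S p <-> carrier_eqn S p.
Proof.
case: S p => [x r e r0|h m h1] [y|] //=.
- rewrite (sphere_eqn_center x r e r0 y) /=; split => [->|/eqP].
    by rewrite subrr mulr0.
  rewrite mulf_eq0 subr_eq0 eqrXn2 ?enorm_ge0 ?ltW // => /orP[|/eqP //].
  by case: e; rewrite ?oppr_eq0 invr_eq0 gt_eqF.
- split=> // /eqP.
  by case: e; rewrite ?oppr_eq0 invr_eq0 gt_eqF.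
- rewrite /sphere_eqn /= mul0r addr0 (dotC h); split => [->|]; first by ring.
  by move=> ?; lra.
Qed.

Lemma sphere_interiorP S y : sphere_interior S y <-> sphere_eqn S y < 0.
Proof.
case: S => [x r e r0|h m h1] /=; last first.
  by rewrite /sphere_eqn /= mul0r addr0 (dotC h); split => ?; lra.
rewrite (sphere_eqn_center x r e r0 y) /=; case: e.
  rewrite pmulr_rlt0 ?invr_gt0 // subr_lt0 ltr_pXn2r ?nnegrE ?enorm_ge0 //.
  exact: ltW.
rewrite nmulr_rlt0 ?oppr_lt0 ?invr_gt0 // subr_gt0 ltr_pXn2r ?nnegrE ?enorm_ge0 //.
exact: ltW.
Qed.

(** * The pairing, and why absolute value at least 1 excludes crossing *)

Definition pairing S T : R := dot (c S) (c T) - (a S * b T + b S * a T) / 2.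

Lemma pairingC S T : pairing S T = pairing T S.
Proof. by rewrite /pairing dotC; ring. Qed.

Lemma pairing_reverse S T : pairing (reverse S) (reverse T) = pairing S T.
Proof.
rewrite /pairing !cocurvature_reverse !signed_curvature_reverse.
by rewrite !scaled_center_reverse !dotE; ring.
Qed.

Lemma pairing_reverser S T : pairing S (reverse T) = - pairing S T.
Proof.
rewrite /pairing cocurvature_reverse signed_curvature_reverse.
by rewrite scaled_center_reverse !dotE; ring.
Qed.

Lemma pairing_self S : pairing S S = 1.
Proof.
rewrite /pairing; case: S => [x r e r0|h m /eqP h1] /=.
  rewrite enorm_sqr !dotE.
  by case: e; rewrite ?invrN invrK; field; rewrite gt_eqF.
by rewrite -enorm_sqr h1; ring.
Qed.

(* The unit normal at [p]. At infinity it is only meaningful for hyperplanes,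
   where it is the same vector as at the finite points. *)
Definition normal S p : 'rV[R]_n :=
  if p is Some y then c S - b S *: y else c S.

(** At a finite point the two sides differ by half of [b S * sphere_eqn T y + b T * sphere_eqn S y];
    at infinity both curvatures vanish. *)
Lemma dot_normal S T p : carrier_eqn S p -> carrier_eqn T p ->
  dot (normal S p) (normal T p) = pairing S T.
Proof.
case: p => [y|] /= hS hT; last by rewrite /pairing hS hT; ring.
have: b S * sphere_eqn T y + b T * sphere_eqn S y = 0 by rewrite hS hT; ring.
rewrite /sphere_eqn /pairing !dotE (dotC y (c T)) => h.
lra.
Qed.

Lemma dot_normal_self S p :
  carrier_eqn S p -> dot (normal S p) (normal S p) = 1.
Proof. by move=> hS; rewrite (dot_normal _ _ _ hS hS) pairing_self. Qed.

Lemma common_point_pairing_le1 S T p :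
  carrier_eqn S p -> carrier_eqn T p -> `|pairing S T| <= 1.
Proof.
move=> hS hT; rewrite -(dot_normal _ _ _ hS hT).
by apply: dot_unit_le1; apply: dot_normal_self.
Qed.

(** Unit vectors with inner product 1 are equal, so the normals agree at both points. As $c-by$ is
    affine in $y$, two finite points determine $b$ and $c$; if one point is at infinity, both
    curvatures are 0. *)
Lemma common_points_normal_eq S T p q : pairing S T = 1 ->
  carrier_eqn S p -> carrier_eqn T p -> carrier_eqn S q -> carrier_eqn T q ->
  p <> q -> [/\ a S = a T, b S = b T & c S = c T].
Proof.
move=> ST1.
have nE u : carrier_eqn S u -> carrier_eqn T u -> normal S u = normal T u.
  move=> hS hT; apply: dot_unit_eq; rewrite ?dot_normal_self //.
  by rewrite dot_normal.
(* The remaining coordinate is read off from the equation at one finite common point. *)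
have finish y : b S = b T -> c S = c T ->
    carrier_eqn S (Some y) -> carrier_eqn T (Some y) ->
    [/\ a S = a T, b S = b T & c S = c T].
  move=> bE cE /= hS hT; split=> //.
  by move: hS hT; rewrite /sphere_eqn bE cE; lra.
move=> Sp Tp Sq Tq; have := nE _ Sp Tp; have := nE _ Sq Tq.
case: p q Sp Tp Sq Tq => [y|] [z|] Sp Tp Sq Tq //= nq np neq.
- have bE : b S = b T.
    apply/eqP; rewrite -subr_eq0; apply/negPn/negP => b0; apply: neq.
    congr Some; apply: (scalerI b0); apply/rowP => i.
    move/rowP: np => /(_ i); move/rowP: nq => /(_ i); rewrite !mxE => ? ?.
    lra.
  by apply: (finish y) => //; move: np; rewrite bE => /addIr.
- by apply: (finish y) => //; rewrite (Sq : b S = 0) (Tq : b T = 0).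
- by apply: (finish z) => //; rewrite (Sp : b S = 0) (Tp : b T = 0).
Qed.

(** The alternatives correspond to at least two, no, or exactly one common point. *)
Lemma pairing1_not_crossing S T : pairing S T = 1 ->
  [\/ coincide S T, disjoint_spheres S T | tangent S T].
Proof.
move=> ST1; case: (pselect (exists p, carrier S p /\ carrier T p)); last first.
  move=> nex; apply: Or32; apply/seteqP; split=> // p -[Sp Tp].
  by case: nex; exists p.
move=> [p [Sp Tp]].
case: (pselect (forall q, carrier S q -> carrier T q -> p = q)) => [uniq|].
  apply: Or33; exists p; apply/seteqP; split => q; first by case=> /uniq h /h.
  by move=> ->.
move=> /existsNP[q] /not_implyP[Sq] /not_implyP[Tq neq]; apply: Or31.
move/carrierP: Sp => Sp; move/carrierP: Tp => Tp.
move/carrierP: Sq => Sq; move/carrierP: Tq => Tq.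
have [aE bE cE] := common_points_normal_eq _ _ _ _ ST1 Sp Tp Sq Tq neq.
have eqnE u : carrier_eqn S u = carrier_eqn T u.
  by case: u => [y|] /=; rewrite /sphere_eqn ?aE ?bE ?cE.
by apply/seteqP; split=> u /carrierP h; apply/carrierP; move: h; rewrite eqnE.
Qed.

(** Above 1, a common point would violate Cauchy-Schwarz for the normals. The value -1 reduces to 1
    by reversing [T], which keeps its carrier. *)
Lemma pairing_ge1_not_crossing S T : 1 <= `|pairing S T| ->
  [\/ coincide S T, disjoint_spheres S T | tangent S T].
Proof.
rewrite le_eqVlt => /orP[|gt1]; last first.
  apply: Or32; apply/seteqP; split=> // p -[/carrierP Sp /carrierP Tp].
  by have := common_point_pairing_le1 _ _ _ Sp Tp; rewrite leNgt gt1.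
rewrite eq_sym eqr_norml ler01 andbT => /orP[/eqP|/eqP STN1].
  exact: pairing1_not_crossing.
have := pairing1_not_crossing S (reverse T).
rewrite pairing_reverser STN1 opprK => /(_ erefl).
by rewrite /coincide /disjoint_spheres /tangent /tangent_at carrier_reverse.
Qed.

(** * From tangency and disjoint interiors to the Gram matrix *)

(* Along the chord [v] from a point of [S], the equation of [S] has no constant
   term. *)
Lemma sphere_eqn_chord S y v : sphere_eqn S y = 0 ->
  sphere_eqn S (y + v) = b S * dot v v - 2 * dot (normal S (Some y)) v.
Proof.
rewrite /sphere_eqn /= !dotE (dotC v y) => h.
by rewrite -[RHS]add0r -h; ring.
Qed.

(** If the absolute value were below 1, the normals at [p] would be linearly independent, and a
    second common point could be constructed. *)
Lemma tangent_pairing_norm S T p : tangent_at S T p -> `|pairing S T| = 1.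
Proof.
move=> STp; have /(_ p) : [set p] `<=` carrier S `&` carrier T by rewrite STp.
move=> /(_ erefl)[/carrierP Sp /carrierP Tp].
have uniq q : carrier_eqn S q -> carrier_eqn T q -> q = p.
  move=> /carrierP Sq /carrierP Tq.
  by have : (carrier S `&` carrier T) q by []; rewrite STp.
apply/eqP; rewrite eq_le (common_point_pairing_le1 _ _ _ Sp Tp) leNgt /=.
apply/negP; rewrite -(dot_normal _ _ _ Sp Tp) => lt1.
have S1 := dot_normal_self _ _ Sp; have T1 := dot_normal_self _ _ Tp.
case: p STp Sp Tp uniq lt1 S1 T1 => [y|] _ Sp Tp uniq lt1 S1 T1.
  (* The second common point is [y + k / |k|^2]: inverting in [y] turns both
     equations into linear ones. *)
  have [k [kS kT]] := dot_unit_solve _ _ (b S / 2) (b T / 2) S1 T1 lt1.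
  (* If [k] is zero, both carriers are hyperplanes and the second common point is [None]. *)
  have [k0|k0] := eqVneq k 0.
    have bS : b S = 0 by move: kS; rewrite k0 -(scale0r 0) dotZr mul0r; lra.
    have bT : b T = 0 by move: kT; rewrite k0 -(scale0r 0) dotZr mul0r; lra.
    by have := uniq None bS bT.
  have kk0 : dot k k != 0.
    by apply: contra k0 => /eqP/dot_eq0 ->.
  have : Some (y + (dot k k)^-1 *: k) = Some y.
    apply: uniq; rewrite /carrier_eqn sphere_eqn_chord // !(dotZl, dotZr) ?kS ?kT;
    by field.
  case=> /(canRL (addKr _)); rewrite addNr => /eqP.
  by rewrite scaler_eq0 invr_eq0 (negbTE kk0) (negbTE k0).
(* Here [p] is infinity, so both are hyperplanes, and non-parallel ones meet at a finite [z]. *)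
have [z [zS zT]] := dot_unit_solve _ _ (a S / 2) (a T / 2) S1 T1 lt1.
have := uniq (Some z); rewrite /= in Sp Tp zS zT.
rewrite /= /sphere_eqn Sp Tp zS zT => h.
by have // : Some z = None by apply: h; field.
Qed.

(** The normals at [p] coincide, and moving along the common normal enters both interiors. *)
Lemma pairing1_interiors_meet S T p : carrier_eqn S p -> carrier_eqn T p ->
  pairing S T = 1 -> exists y, sphere_interior S y /\ sphere_interior T y.
Proof.
move=> Sp Tp ST1.
have S1 := dot_normal_self _ _ Sp; have T1 := dot_normal_self _ _ Tp.
have nE : normal S p = normal T p.
  by apply: dot_unit_eq => //; rewrite dot_normal.
case: p Sp Tp S1 T1 nE => [y|] Sp Tp S1 T1 nE.
  (* At distance [t] along the normal the equation takes the value $t(tb-2)$; this [t] makes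
     $tb\le1$ for both curvatures. *)
  pose t := (1 + `|b S| + `|b T|)^-1.
  have d0 : 0 < 1 + `|b S| + `|b T|.
    by rewrite -addrA ltr_wpDr ?addr_ge0.
  have t0 : 0 < t by rewrite invr_gt0.
  have tE : t * (1 + `|b S| + `|b T|) = 1 by rewrite mulVf // gt_eqF.
  have := normr_ge0 (b S); have := normr_ge0 (b T).
  have := ler_norm (b S); have := ler_norm (b T) => leT leS T0 S0.
  have key (u : R) : u <= `|b S| + `|b T| -> u * (t * (t * 1)) - 2 * (t * 1) < 0.
    move=> hu; have := ler_wpM2l (ltW t0) hu => tu.
    have -> : u * (t * (t * 1)) - 2 * (t * 1) = t * (t * u - 2) by ring.
    by rewrite pmulr_rlt0 //; lra.
  exists (y + t *: normal S (Some y)); split; apply/sphere_interiorP.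
    by rewrite sphere_eqn_chord // !(dotZl, dotZr) S1; apply: key; lra.
  by rewrite sphere_eqn_chord // nE !(dotZl, dotZr) T1; apply: key; lra.
rewrite /= in Sp Tp S1 T1 nE.
(* Two half-spaces with the same normal: a point far enough along it lies in both. *)
exists ((1 + `|a S| + `|a T|) *: c S).
have := normr_ge0 (a S); have := normr_ge0 (a T).
have := ler_norm (a S); have := ler_norm (a T) => leT leS T0 S0.
split; apply/sphere_interiorP; rewrite /sphere_eqn ?Sp ?Tp mul0r addr0 dotZr.
  by rewrite S1; lra.
by rewrite nE T1; lra.
Qed.

Lemma tangent_disjoint_pairing S T : tangent S T ->
  sphere_interior S `&` sphere_interior T = set0 -> pairing S T = - 1.
Proof.
move=> [p STp] disj; have /eqP := tangent_pairing_norm _ _ _ STp.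
rewrite eqr_norml ler01 andbT => /orP[/eqP ST1|/eqP //].
have /(_ p) : [set p] `<=` carrier S `&` carrier T by rewrite STp.
move=> /(_ erefl)[/carrierP Sp /carrierP Tp].
have [y [Sy Ty]] := pairing1_interiors_meet _ _ _ Sp Tp ST1.
by have : (sphere_interior S `&` sphere_interior T) y by []; rewrite disj.
Qed.

(** Reversing both orientations preserves the pairing, so the two alternatives for the orientation
    give the same Gram matrix. *)
Lemma descartes_pairing (D : ordered_spheres R n) (i j : 'I_n.+2) :
  oriented_descartes D -> pairing (D i) (D j) = 2 * (i == j)%:R - 1.
Proof.
move=> [[tang _] disj]; have [->|neq] := eqVneq i j.
  by rewrite pairing_self /=; ring.
rewrite mulr0 sub0r; case: disj => /(_ _ _ neq) disj.
  by apply: tangent_disjoint_pairing => //; exact: tang.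
rewrite -pairing_reverse; apply: tangent_disjoint_pairing => //.
by rewrite /tangent /tangent_at !carrier_reverse; exact: tang.
Qed.

(* Twice the inverse of the paper's $Q_{W,n}$. *)
Definition pairing_mx : 'M[R]_(1 + (1 + n)) :=
  block_mx (0 : 'M_1) (row_mx (- 2^-1)%:M 0)
    (col_mx (- 2^-1)%:M 0) (block_mx (0 : 'M_1) 0 0 1%:M).

Lemma acc_coords_pairing S T :
  (acc_coords S *m pairing_mx *m (acc_coords T)^T) 0 0 = pairing S T.
Proof.
rewrite !acc_coordsE /pairing_mx mul_row_block !tr_row_mx mul_row_col.
rewrite mulmx0 add0r mul_row_col mulmx0 addr0.
rewrite mul_mx_row mul_row_block !mulmx0 mulmx1.
rewrite !add0r add_row_mx addr0 add0r mul_row_col.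
rewrite !tr_scalar_mx -!scalar_mxM !mxE /= !mulr1n.
rewrite /pairing /dot; under eq_bigr do rewrite mxE.
by field.
Qed.

Lemma pairing_mxE (D1 D2 : ordered_spheres R n) i j :
  ((acc_matrix D1 : 'M_(n.+2, 1 + (1 + n))) *m pairing_mx *m
    (acc_matrix D2)^T) i j = pairing (D1 i) (D2 j).
Proof.
have rowE (D : ordered_spheres R n) k :
    row k (acc_matrix D : 'M_(n.+2, 1 + (1 + n))) = acc_coords (D k).
  by apply/rowP => l; rewrite !mxE.
rewrite -acc_coords_pairing -!rowE -!row_mul tr_row !mxE.
by apply: eq_bigr => k _; rewrite !mxE.
Qed.

End Coordinates.

(** * Congruence modulo 2 in the dual Apollonian group *)

Section Congruence.
Context {R : realType} {n : nat}.
Implicit Types U V : 'M[R]_n.+2.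

(** The integer witness makes integrality of the real matrix [U] part of the congruence. *)
Definition congr1_mod2 U : Prop :=
  exists Z : 'M[int]_n.+2, U = 1%:M + 2 *: map_mx intr Z.

Lemma congr1_mod2_1 : congr1_mod2 1%:M.
Proof. by exists 0; rewrite map_mx0 scaler0 addr0. Qed.

Lemma congr1_mod2M U V : congr1_mod2 U -> congr1_mod2 V -> congr1_mod2 (U *m V).
Proof.
move=> [Y ->] [Z ->]; exists (Y + Z + 2 *: (Y *m Z)).
rewrite !map_mxD map_mxZ map_mxM /= mulmxDl !mulmxDr mul1mx mulmx1 mul1mx.
rewrite -scalemxAl -scalemxAr !scalerDr !addrA.
by rewrite [_ + _ *: map_mx _ Z + _]addrAC.
Qed.

Lemma dual_genE j : dual_gen j = 1%:M +
  2 *: map_mx intr ((const_mx 1 : 'cV[int]_n.+2) *m delta_mx 0 j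
    - 2 *: delta_mx j j) :> 'M[R]_n.+2.
Proof.
rewrite map_mxB map_mxZ map_mxM /= !map_delta_mx map_const_mx.
rewrite /dual_gen scalerBr scalerA addrA; congr (_ - _ *: _).
by ring.
Qed.

(** The generator is a reflection $I+v e_j^T$ with $e_j^T v=-2$, so the rank-one terms of its square
    cancel. *)
Lemma dual_gen_involutive j : dual_gen j *m dual_gen j = 1%:M :> 'M[R]_n.+2.
Proof.
pose v : 'cV[R]_n.+2 := 2 *: const_mx 1 - 4 *: delta_mx j 0.
have gE : dual_gen j = 1%:M + v *m delta_mx 0 j :> 'M[R]_n.+2.
  rewrite /dual_gen /v mulmxBl -!scalemxAl mul_delta_mx.
  by rewrite addrA.
have vj : delta_mx 0 j *m v = (- 2)%:M :> 'M[R]_1.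
  rewrite -rowE; apply/matrixP => s t; rewrite !ord1 !mxE !eqxx /=.
  by ring.
rewrite gE mulmxDl mul1mx mulmxDr mulmx1 mulmxA -(mulmxA v) vj.
rewrite mul_mx_scalar -scalemxAl; move: (v *m _) => w.
by apply/matrixP => s t; rewrite !mxE; ring.
Qed.

(** The induction carries the inverse along: generators are their own inverses, and inversion swaps
    the two congruences. Invertibility justifies the rule for the inverse of a product. *)
Lemma dual_apollonian_congr1 U : dual_apollonian U ->
  [/\ U \in unitmx, congr1_mod2 U & congr1_mod2 (invmx U)].
Proof.
elim=> [j| |{}U V _ [uU cU cVU] _ [uV cV cVV]|{}U _ [uU cU cVU]].
- have [uj _] := mulmx1_unit (dual_gen_involutive j).
  have -> : invmx (dual_gen j) = dual_gen j :> 'M[R]_n.+2.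
    by rewrite -[RHS]mul1mx -(mulVmx uj) -mulmxA dual_gen_involutive mulmx1.
  have cj : congr1_mod2 (dual_gen j) by rewrite dual_genE; eexists.
  by split.
- by rewrite invmx1; split; [exact: unitmx1|exact: congr1_mod2_1..].
- split; [by rewrite unitmx_mul uU|exact: congr1_mod2M|].
  suff -> : invmx (U *m V) = invmx V *m invmx U by exact: congr1_mod2M.
  have uUV : U *m V \in unitmx by rewrite unitmx_mul uU.
  by rewrite -[RHS](mulmxK uUV) mulmxA mulmxKV // mulVmx // mul1mx.
- by rewrite unitmx_inv invmxK.
Qed.

Lemma congr1_mod2_gram_odd U V i j : congr1_mod2 U -> congr1_mod2 V ->
  exists z : int,
    (U *m (2 *: 1%:M - const_mx 1) *m V^T) i j = (2 * z - 1)%:~R :> R.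
Proof.
move=> [Y ->] [Z ->]; pose G : 'M[int]_n.+2 := 2 *: 1%:M - const_mx 1.
have gE : 2 *: 1%:M - const_mx 1 = map_mx intr G :> 'M[R]_n.+2.
  by rewrite map_mxB map_mxZ map_mx1 map_const_mx.
(* With $J=\mathbf 1\mathbf 1^T$ and $G=2I-J$, expanding $(I+2Y)G(I+2Z)^T$ gives twice this matrix
   minus $J$. *)
exists ((1%:M + Y *m G + G *m Z^T + 2 *: (Y *m G *m Z^T)) i j).
set X := 1%:M + _ + _ + _; have -> : (1%:M + 2 *: map_mx intr Y) *m
    (2 *: 1%:M - const_mx 1) *m (1%:M + 2 *: map_mx intr Z)^T =
    2 *: map_mx intr X - const_mx 1 :> 'M[R]_n.+2.
  rewrite /X !map_mxD map_mx1 map_mxZ !map_mxM -!map_trmx /= -gE.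
  rewrite [(_ + _)^T]linearD /= [(_ *: _)^T]linearZ /= trmx1.
  move: (map_mx _ Y) (map_mx _ Z)^T => y z.
  rewrite mulmxDl mul1mx mulmxDr mulmx1 mulmxDl -!(scalemxAl, scalemxAr).
  set C := y *m _ *m z; set A := y *m _; set B := _ *m z.
  by apply/matrixP => s t; rewrite !mxE; ring.
by rewrite !mxE intrB intrM.
Qed.

End Congruence.

Theorem theorem4p3 (R : realType) (n : nat) (hn : (2 <= n)%N)
    (D : ordered_spheres R n) (hD : oriented_descartes D)
    (D1 D2 : ordered_spheres R n)
    (hD1 : dual_orbit D D1) (hD2 : dual_orbit D D2) (hneq : D1 <> D2)
    (i j : 'I_n.+2) :
  [\/ coincide (D1 i) (D2 j), disjoint_spheres (D1 i) (D2 j)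
    | tangent (D1 i) (D2 j)].
Proof.
apply: pairing_ge1_not_crossing; rewrite -pairing_mxE.
have gram : acc_matrix D *m pairing_mx *m (acc_matrix D)^T =
    2 *: 1%:M - const_mx 1.
  by apply/matrixP => s t; rewrite pairing_mxE descartes_pairing // !mxE.
case: hD1 hD2 => [_ [U /dual_apollonian_congr1[_ cU _] ->]].
move=> [_ [V /dual_apollonian_congr1[_ cV _] ->]].
(* The Gram matrix of [D] appears in the middle, so only [U] and [V] still matter. *)
have -> : U *m acc_matrix D *m pairing_mx *m (V *m acc_matrix D)^T =
    U *m (2 *: 1%:M - const_mx 1) *m V^T.
  by rewrite -gram trmx_mul !mulmxA.
have [z ->] := congr1_mod2_gram_odd U V i j cU cV.
by rewrite -intr_norm ler1z; lia.
Qed.
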